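(* Let $d \ge 1$, $n \ge 2$ be integers and let $p = (p_1,\dots,p_d) \in (0,1)^d$. Let $\mathbf{x} = \{x_1,\dots,x_n\}$ be i.i.d. random vectors in $\{0,1\}^d$ with distribution $\mathrm{Bernoulli}(p)$. Let $\alpha$ be a real number with $$0 < \alpha \le \min\left(\frac{1-p_i}{p_i}, \frac{p_i}{1-p_i}\right) \quad \text{for every } i \in \{1,\dots,d\},$$ and let $\mathbf{z} = \{z_1,\dots,z_n\}$ be the random vectors generated by the discrepancy-based sampling algorithm (DBsample) with inputs $p$, $n$, $\alpha$. Then $$\mathbb{E}\big[\|D_p(\mathbf{z})\|^2\big] < \mathbb{E}\big[\|D_p(\mathbf{x})\|^2\big].$$
   Context: For $q \in [0,1]^d$, $\mathrm{Bernoulli}(q)$ denotes the distribution on $\{0,1\}^d$ whose coordinates are independent, the $i$-th coordinate being Bernoulli with success probability $q_i$. Discrepancy: for a family of samples $\mathbf{y} = \{y_1,\dots,y_n\}$ in $\{0,1\}^d$ (repetitions allowed), $D_p(\mathbf{y}) = \frac{1}{n}\sum_{k=1}^n y_k - p \in \mathbb{R}^d$. The norm $\|\cdot\|$ is the Euclidean norm. DBsample with inputs $p \in [0,1]^d$, $n \in \mathbb{N}$ and correction factor $\alpha$ generates random vectors $z_1,\dots,z_n \in \{0,1\}^d$ sequentially: $z_1 \sim \mathrm{Bernoulli}(q_1)$ with $q_1 = p$; for $k = 2,\dots,n$, put $\hat{p}_{k-1} = \frac{1}{k-1}\sum_{j=1}^{k-1} z_j$ and $$q_k = \min\big(1, (p(1+\alpha)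 - \alpha\hat{p}_{k-1})_+\big) \quad \text{(coordinatewise, with } (t)_+ = \max(t,0)\text{)},$$ and, conditionally on $z_1,\dots,z_{k-1}$, draw $z_k \sim \mathrm{Bernoulli}(q_k)$. *)

(* Defs.v *)
From HB Require Import structures.
From mathcomp Require Import all_boot all_order all_algebra.
From mathcomp Require Import all_classical all_reals all_analysis.

Set Implicit Arguments.
Unset Strict Implicit.
Unset Printing Implicit Defensive.

Import Order.TTheory GRing.Theory Num.Theory.

Local Open Scope classical_set_scope.
Local Open Scope ring_scope.

(* The Boolean cube {0,1}^d is [d.-tuple bool], with [true] standing for 1;
   samples y_1, ..., y_n are indexed from 0 by ['I_n]. *)

Definition bvec (R : realType) (d : nat) (v : d.-tuple bool) : 'rV[R]_d :=
  \row_i (tnth v i)%:R.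

(* The library norm on ['rV[R]_d] is the sup norm, hence this definition. *)
Definition enorm (R : realType) (d : nat) (u : 'rV[R]_d) : R :=
  Num.sqrt (\sum_i u 0 i ^+ 2).

Definition discrepancy (R : realType) (n d : nat) (p : 'rV[R]_d)
    (y : 'I_n -> d.-tuple bool) : 'rV[R]_d :=
  n%:R^-1 *: (\sum_k bvec R (y k)) - p.

Definition Bernoulli_pmf (R : realType) (d : nat) (q : 'rV[R]_d)
    (v : d.-tuple bool) : R :=
  \prod_i bernoulli_pmf (q 0 i) (tnth v i).

Definition has_Bernoulli_law (dO : measure_display) (Omega : measurableType dO)
    (R : realType) (P : probability Omega R) (d : nat) (q : 'rV[R]_d)
    (X : {RV P >-> d.-tuple bool}) : Prop :=
  forall v, distribution P X [set v] = (Bernoulli_pmf q v)%:E.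

Definition mutually_independent (dO dT : measure_display)
    (Omega : measurableType dO) (T : measurableType dT) (R : realType)
    (P : probability Omega R) (n : nat) (X : 'I_n -> {RV P >-> T}) : Prop :=
  forall (J : {set 'I_n}) (A : 'I_n -> set T), (forall k, measurable (A k)) ->
    P (\bigcap_(k in [set` J]) (X k @^-1` A k)) =
    (\prod_(k in J) P (X k @^-1` A k))%E.

(* Meaningful when B has positive probability. *)
Definition cond_pr (dO : measure_display) (Omega : measurableType dO)
    (R : realType) (P : probability Omega R) (A B : set Omega) : R :=
  fine (P (A `&` B)) / fine (P B).

(* Mean of the first k samples. *)
Definition prefix_mean (R : realType) (n d : nat) (z : 'I_n -> d.-tuple bool)
    (k : nat) : 'rV[R]_d :=
  k%:R^-1 *: \sum_(j < n | (j < k)%N) bvec R (z j).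

(* The parameter q used to draw the sample of (0-based) index k, given the
   previous samples z_j, j < k. *)
Definition DBparam (R : realType) (n d : nat) (p : 'rV[R]_d) (alpha : R)
    (z : 'I_n -> d.-tuple bool) (k : nat) : 'rV[R]_d :=
  if k == 0%N then p
  else \row_i Num.min 1
         (Num.max (p 0 i * (1 + alpha) - alpha * prefix_mean R z k 0 i) 0).

(* Z is an output of DBsample: given any history Z_j = u_j (j < k) of positive
   probability, Z_k has law Bernoulli(q_k). For k = 0 the history is the whole
   space, so that Z_0 has law Bernoulli(p). *)
Definition is_DBsample (dO : measure_display) (Omega : measurableType dO)
    (R : realType) (P : probability Omega R) (n d : nat) (p : 'rV[R]_d)
    (alpha : R) (Z : 'I_n -> {RV P >-> d.-tuple bool}) : Prop :=
  forall (k : 'I_n) (u : 'I_n -> d.-tuple bool),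
    let history := [set w | forall j : 'I_n, (j < k)%N -> Z j w = u j] in
    P history != 0%E ->
    forall v, cond_pr P (Z k @^-1` [set v]) history =
              Bernoulli_pmf (DBparam p alpha u k) v.

Arguments has_Bernoulli_law {dO Omega R} P {d} q X.
Arguments mutually_independent {dO dT Omega T R} P {n} X.
Arguments is_DBsample {dO Omega R} P {n d} p alpha Z.

(* Main.v *)
(* Write S_k for a coordinate of the sum of z_j - p over the first k samples.
   The bound on alpha makes the clipping in q_k inactive, so that the increment
   drawn after k samples has conditional mean -(alpha / k) S_k. Hence
   E S_k = 0, and since z^2 = z for z in {0,1},
     E S_(k+1)^2 = (1 - 2 alpha / k) E S_k^2 + p (1 - p).
   For alpha = 0, which is i.i.d. sampling, this gives E S_n^2 = n p (1 - p);
   for alpha > 0 the recursion loses strictly at k = 1 as E S_1^2 > 0. *)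

Require Import Defs.
From HB Require Import structures.
From mathcomp Require Import all_boot all_order all_algebra.
From mathcomp Require Import all_classical all_reals all_analysis.
From mathcomp Require Import ring lra.

Set Implicit Arguments.
Unset Strict Implicit.
Unset Printing Implicit Defensive.

Import Order.TTheory GRing.Theory Num.Theory.

Local Open Scope classical_set_scope.
Local Open Scope ring_scope.

(** * Finite-valued random variables and Bernoulli vectors *)

Lemma measurable_tuple1 (d : nat) (v : d.-tuple bool) : measurable [set v].
Proof.
have -> : [set v] =
    \bigcap_(i in [set: 'I_d]) ((@tnth _ _ ^~ i) @^-1` [set tnth v i]).
  apply/seteqP; split=> [_ -> //|x /= xv].
  by apply: eq_from_tnth => i; exact: xv.
apply: fin_bigcap_measurable => // i _.
by rewrite -[X in measurable X]setTI; exact: measurable_tnth.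
Qed.

Section finite_valued.
Context (dO : measure_display) (Omega : measurableType dO) (R : realType)
  (P : probability Omega R) (T : finType) (Y : Omega -> T).
Hypothesis mY : forall u, measurable (Y @^-1` [set u]).

Lemma measurable_preimage_fin (A : set T) : measurable (Y @^-1` A).
Proof.
have -> : Y @^-1` A = \bigcup_(u in A) Y @^-1` [set u].
  apply/seteqP; split=> [w /= Aw|w [u Au Yw]].
    by exists (Y w).
  by rewrite /preimage /= Yw.
by apply: fin_bigcup_measurable => //; exact: finite_finset.
Qed.

(** The composite of [f] and [Y] is a finite combination of indicators of the fibres of [Y], so
    linearity of the integral applies. *)
Lemma expectation_fin (f : T -> R) : 'E_P[fun w => f (Y w)]%E =
  (\sum_u fine (P (Y @^-1` [set u])) * f u)%:E.
Proof.
rewrite expectation.unlock.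
transitivity (\int[P]_w \sum_u (f u)%:E * (\1_(Y @^-1` [set u]) w)%:E)%E.
  apply: eq_integral => w _.
  rewrite (bigD1 (Y w)) //= big1 => [|u /eqP uY].
    by rewrite indicE mem_set //= mule1 adde0.
  by rewrite indicE memNset ?mule0 //= => /esym.
have iI u : P.-integrable setT (EFin \o \1_(Y @^-1` [set u])).
  by apply: integrable_indic.
rewrite integral_sum //=; last first.
  by move=> u; apply: integrableZl => //; exact: iI.
rewrite -(sumEFin _ xpredT); apply: eq_bigr => u _.
rewrite integralZl //; last exact: iI.
rewrite integral_indic // setIT muleC EFinM fineK //.
exact: fin_num_measure.
Qed.

Lemma prob_preimage_fin (Q : pred T) : fine (P [set w | Q (Y w)]) =
  \sum_(u | Q u) fine (P (Y @^-1` [set u])).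
Proof.
have mQ : measurable [set w | Q (Y w)] := measurable_preimage_fin [set u | Q u].
have := expectation_fin (fun u => (Q u)%:R).
rewrite expectation.unlock.
under eq_integral => w _.
  have -> : ((Q (Y w))%:R)%:E = (\1_[set w | Q (Y w)] w)%:E :> \bar R.
    by rewrite indicE mem_setE.
  over.
rewrite integral_indic // setIT => ->/=.
by rewrite [RHS]big_mkcond; apply: eq_bigr => u _; case: (Q u);
  rewrite ?mulr1 ?mulr0.
Qed.

End finite_valued.

(** The bit at [i] is absorbed into the [i]-th factor of the product, and the sum over the cube
    becomes a product of sums over [bool]: the factor at [i] is [q 0 i], every other one is a total
    mass 1. *)
Lemma Bernoulli_mean (R : realType) (d : nat) (q : 'rV[R]_d) (i : 'I_d) :
  \sum_v Bernoulli_pmf q v * (tnth v i)%:R = q 0 i.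
Proof.
pose F j (b : bool) : R :=
  bernoulli_pmf (q 0 j) b * (if j == i then b%:R else 1).
transitivity (\sum_(f : {ffun 'I_d -> bool}) \prod_j F j (f j)).
  rewrite (reindex (fun f : {ffun 'I_d -> bool} => mktuple f)); last first.
    exists (fun v => [ffun j => tnth v j]) => [f _|v _].
      by apply/ffunP => j; rewrite ffunE tnth_mktuple.
    by apply: eq_from_tnth => j; rewrite tnth_mktuple ffunE.
  apply: eq_bigr => f _; rewrite big_split /= -big_mkcond big_pred1_eq.
  rewrite tnth_mktuple; congr (_ * _).
  by apply: eq_bigr => j _; rewrite tnth_mktuple.
rewrite -bigA_distr_bigA (bigD1 i) //= [X in _ * X]big1; last first.
  by move=> j /negbTE ji; rewrite big_bool /F ji /bernoulli_pmf /= !mulr1; lra.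
by rewrite big_bool /F eqxx /bernoulli_pmf /= mulr1 !mulr0 addr0 mulr1.
Qed.

(** * Partial sums of deviations and the unclipped parameter *)

(** Coordinate [i] of the partial sum S_k. Filtering ['I_n] keeps one index type for all [k]. *)
Definition deviation (R : realType) (n d : nat) (p : 'rV[R]_d)
    (u : 'I_n -> d.-tuple bool) (k : nat) (i : 'I_d) : R :=
  \sum_(j < n | (j < k)%N) ((tnth (u j) i)%:R - p 0 i).

Section deviation_lemmas.
Variables (R : realType) (n d : nat) (p : 'rV[R]_d) (i : 'I_d).
Implicit Types u : 'I_n -> d.-tuple bool.

Lemma deviation0 u : deviation p u 0 i = 0.
Proof. exact: big_pred0. Qed.

Lemma deviationS u (k : 'I_n) :
  deviation p u k.+1 i = deviation p u k i + ((tnth (u k) i)%:R - p 0 i).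
Proof.
rewrite /deviation (bigD1 k) /= ?ltnS // addrC; congr (_ + _).
by apply: eq_bigl => j; rewrite ltnS ltn_neqAle andbC.
Qed.

Lemma eq_deviation u v (k : nat) : (forall j : 'I_n, (j < k)%N -> u j = v j) ->
  deviation p u k i = deviation p v k i.
Proof. by move=> uv; apply: eq_bigr => j /uv ->. Qed.

Lemma deviation_mean u (k : nat) : (0 < k <= n)%N ->
  deviation p u k i = k%:R * (prefix_mean R u k 0 i - p 0 i).
Proof.
case/andP=> k0 kn; rewrite /deviation sumrB /prefix_mean mxE summxE.
rewrite -(big_ord_widen n (fun=> p 0 i) kn) sumr_const card_ord.
rewrite mulrBr mulVKf ?pnatr_eq0 -?lt0n // mulr_natl; congr (_ - _).
by apply: eq_bigr => j _; rewrite mxE.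
Qed.

Lemma prefix_mean_itv u (k : nat) : (k <= n)%N ->
  0 <= prefix_mean R u k 0 i <= 1.
Proof.
move=> kn; rewrite /prefix_mean mxE summxE; apply/andP; split.
  by rewrite mulr_ge0 ?invr_ge0 //; apply: sumr_ge0 => j _; rewrite mxE.
(* The inverse of 0 is 0, so the empty prefix has mean 0. *)
case: (posnP k) => [->|k0]; first by rewrite invr0 mul0r.
rewrite mulrC ler_pdivrMr ?ltr0n // mul1r.
have -> : k%:R = \sum_(j < n | (j < k)%N) (1 : R).
  by rewrite -(big_ord_widen n (fun=> 1) kn) sumr_const card_ord.
by apply: ler_sum => j _; rewrite mxE lern1 leq_b1.
Qed.

(* For k = 0 both sides are p_i because 0^-1 = 0. *)
Lemma DBparamE (alpha : R) u (k : nat) : (k <= n)%N -> 0 <= alpha ->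
  alpha * p 0 i <= 1 - p 0 i -> alpha * (1 - p 0 i) <= p 0 i ->
  DBparam p alpha u k 0 i = p 0 i - alpha / k%:R * deviation p u k i.
Proof.
move=> kn a0 ap1 ap2; rewrite /DBparam; case: (posnP k) => [->|k0] /=.
  by rewrite deviation0 mulr0 subr0.
rewrite mxE deviation_mean ?k0 //.
have /andP[m0 m1] := prefix_mean_itv u kn.
set m := prefix_mean _ _ _ _ _ in m0 m1 *.
have am0 : 0 <= alpha * m by rewrite mulr_ge0.
have am1 : alpha * m <= alpha by rewrite ler_piMr.
rewrite mulrA divfK ?pnatr_eq0 -?lt0n //.
(* The unclipped value is smallest at m = 1, where [ap2] makes it nonnegative, and largest at m = 0,
   where [ap1] keeps it at most 1. *)
rewrite max_l; last by lra.
rewrite min_r; last by lra.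
by ring.
Qed.

Lemma eq_DBparam (alpha : R) u v (k : nat) :
  (forall j : 'I_n, (j < k)%N -> u j = v j) ->
  DBparam p alpha u k = DBparam p alpha v k.
Proof.
move=> uv; rewrite /DBparam /prefix_mean.
by rewrite (eq_bigr (fun j => bvec R (v j))) // => j /uv ->.
Qed.

End deviation_lemmas.

(** The discrepancy is S_n / n, so the problem splits over coordinates. *)
Lemma sqr_enorm_discrepancy (R : realType) (n d : nat) (p : 'rV[R]_d)
    (u : 'I_n -> d.-tuple bool) : (0 < n)%N ->
  enorm (discrepancy p u) ^+ 2 = n%:R ^- 2 * \sum_i deviation p u n i ^+ 2.
Proof.
move=> n0; rewrite /enorm sqr_sqrtr; last first.
  by apply: sumr_ge0 => i _; exact: sqr_ge0.
rewrite mulr_sumr; apply: eq_bigr => i _.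
have n_neq0 : n%:R != 0 :> R by rewrite pnatr_eq0 -lt0n.
rewrite deviation_mean ?n0 ?leqnn // exprMn mulKf ?expf_neq0 //.
rewrite !mxE; congr ((_ * _ - _) ^+ 2).
by rewrite !summxE; apply: eq_big => j; rewrite ?ltn_ord.
Qed.

(** * Recursion for the second moment in one coordinate *)

Section second_moment.
Variables (R : realType) (d n : nat) (p : 'rV[R]_d) (i : 'I_d) (alpha : R).
Implicit Types u v : {ffun 'I_n -> d.-tuple bool}.
(** The joint law of all samples is kept abstract, so that one recursion serves both schemes. *)
Variable pmf : {ffun 'I_n -> d.-tuple bool} -> R.
Hypothesis pmf_ge0 : forall u, 0 <= pmf u.
Hypothesis sum_pmf1 : \sum_u pmf u = 1.
(* The conditional mean of the draw of index k given the earlier ones, tested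
   against functions g of the first k samples. *)
Hypothesis pmf_step : forall (k : 'I_n) (g : {ffun 'I_n -> d.-tuple bool} -> R),
  (forall u v, (forall j : 'I_n, (j < k)%N -> u j = v j) -> g u = g v) ->
  \sum_u pmf u * (g u * (tnth (u k) i)%:R) =
  \sum_u pmf u * (g u * (p 0 i - alpha / k%:R * deviation p u k i)).

Definition second_moment (k : nat) : R :=
  \sum_u pmf u * deviation p u k i ^+ 2.

(** Testing against the constant 1, the new draw has mean p - (alpha / k) E S_k, which is p by
    induction. *)
Lemma mean_deviation (k : nat) : (k <= n)%N ->
  \sum_u pmf u * deviation p u k i = 0.
Proof.
elim: k => [_|k IH kn].
  by apply: big1 => u _; rewrite deviation0 mulr0.
pose k' := Ordinal kn.
transitivity (\sum_u (pmf u * deviation p u k i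
    + pmf u * (1 * (tnth (u k') i)%:R) - p 0 i * pmf u)).
  by apply: eq_bigr => u _; rewrite (deviationS _ _ _ k') /=; ring.
rewrite sumrB big_split /= (@pmf_step k' (fun=> 1)) //.
rewrite [X in X + _ - _](IH (ltnW kn)) -[X in _ - X]mulr_sumr sum_pmf1.
transitivity (\sum_u (p 0 i * pmf u
    - alpha / k%:R * (pmf u * deviation p u k i)) - p 0 i).
  by rewrite add0r mulr1; congr (_ - _); apply: eq_bigr => u _; ring.
by rewrite sumrB -!mulr_sumr sum_pmf1 (IH (ltnW kn)); ring.
Qed.

(** At k = 0 the quotient by k is 0 by convention, so the recursion also covers the first draw. *)
Lemma second_momentS (k : nat) : (k < n)%N ->
  second_moment k.+1 =
  second_moment k * (1 - 2 * alpha / k%:R) + p 0 i * (1 - p 0 i).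
Proof.
move=> kn; pose k' := Ordinal kn.
(* [g] is the coefficient of z in (S_k + z - p)^2 after replacing z^2 by z; it depends only on the
   first k samples. *)
pose g (u : {ffun 'I_n -> d.-tuple bool}) :=
  2 * deviation p u k i + (1 - 2 * p 0 i).
have gP u v : (forall j : 'I_n, (j < k')%N -> u j = v j) -> g u = g v.
  by move=> uv; rewrite /g (eq_deviation _ _ uv).
transitivity (\sum_u (pmf u * deviation p u k i ^+ 2
    + pmf u * (g u * (tnth (u k') i)%:R)
    - 2 * p 0 i * (pmf u * deviation p u k i) + p 0 i ^+ 2 * pmf u)).
  apply: eq_bigr => u _; rewrite /g (deviationS _ _ _ k') /=.
  by case: (tnth _ _); rewrite /= ?mulr1n ?mulr0n; ring.
rewrite !big_split /= sumrN (pmf_step gP) -!mulr_sumr.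
rewrite (mean_deviation (ltnW kn)) sum_pmf1.
(* With z replaced by its conditional mean, terms are sorted by powers of S_k; the linear one has
   mean 0. *)
transitivity (second_moment k + \sum_u (
    (- (2 * (alpha / k%:R))) * (pmf u * deviation p u k i ^+ 2)
    + (2 * p 0 i - (1 - 2 * p 0 i) * (alpha / k%:R))
      * (pmf u * deviation p u k i)
    + (1 - 2 * p 0 i) * p 0 i * pmf u) + p 0 i ^+ 2).
  rewrite mulr0 subr0 mulr1; congr (_ + _ + _).
  by apply: eq_bigr => u _; rewrite /g /=; ring.
rewrite !big_split /= -!mulr_sumr (mean_deviation (ltnW kn)) sum_pmf1.
by rewrite -/(second_moment k); ring.
Qed.

Lemma second_moment0 : second_moment 0 = 0.
Proof. by apply: big1 => u _; rewrite deviation0 expr0n mulr0. Qed.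

Lemma second_moment_ge0 k : 0 <= second_moment k.
Proof. by apply: sumr_ge0 => u _; rewrite mulr_ge0 ?sqr_ge0. Qed.

Lemma second_moment_alpha0 (k : nat) : alpha = 0 -> (k <= n)%N ->
  second_moment k = k%:R * (p 0 i * (1 - p 0 i)).
Proof.
move=> a0; elim: k => [_|k IH kn]; first by rewrite second_moment0 mul0r.
by rewrite (second_momentS kn) (IH (ltnW kn)) a0 -natr1; ring.
Qed.

(** One sample gives equality; at two samples the gap is 2 alpha p (1 - p), and each later step only
    subtracts a further nonnegative term. *)
Lemma second_moment_lt (k : nat) : 0 < alpha -> 0 < p 0 i < 1 ->
  (2 <= k <= n)%N -> second_moment k < k%:R * (p 0 i * (1 - p 0 i)).
Proof.
move=> a0 /andP[p0 p1]; have pq0 : 0 < p 0 i * (1 - p 0 i).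
  by rewrite mulr_gt0 // subr_gt0.
case: k => [|[|k]] // /andP[_]; elim: k => [|k IH] kn.
  rewrite !second_momentS ?second_moment0 //; last exact: ltnW.
  have : 0 < alpha * (p 0 i * (1 - p 0 i)) by rewrite mulr_gt0.
  by rewrite invr1; lra.
rewrite second_momentS // -[in ltRHS]natr1.
have := IH (ltnW kn); have := second_moment_ge0 k.+2.
set v := second_moment _; set c := 2 * alpha / _ => v0.
have : 0 <= v * c by rewrite mulr_ge0 // divr_ge0 // mulr_ge0 // ltW.
by lra.
Qed.

End second_moment.

(** * Joint law of the samples of DBsample *)

Section DBsample.
Variables (R : realType) (d n : nat) (p : 'rV[R]_d) (alpha : R).
Context (dO : measure_display) (Omega : measurableType dO)
  (P : probability Omega R) (Z : 'I_n -> {RV P >-> d.-tuple bool}).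
Hypothesis Z_DB : is_DBsample P p alpha Z.

Implicit Types u v h : {ffun 'I_n -> d.-tuple bool}.

(** Gathering the samples in one element of a finite type turns expectations into finite sums. *)
Let joint (w : Omega) : {ffun 'I_n -> d.-tuple bool} := [ffun k => Z k w].

Let pmf (u : {ffun 'I_n -> d.-tuple bool}) : R :=
  fine (P (joint @^-1` [set u])).

Local Lemma measurable_joint u : measurable (joint @^-1` [set u]).
Proof.
have -> : joint @^-1` [set u] =
    \bigcap_(k in [set: 'I_n]) (Z k @^-1` [set u k]).
  apply/seteqP; split=> [w /= <- k _ /=|w /= Zu]; first by rewrite ffunE.
  by apply/ffunP => k; rewrite ffunE; exact: Zu.
apply: fin_bigcap_measurable => // k _.
by apply: measurable_funPTI; exact: measurable_tuple1.
Qed.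

Local Lemma pmf_ge0 u : 0 <= pmf u.
Proof. exact: fine_ge0. Qed.

Local Lemma sum_pmf (Q : pred {ffun 'I_n -> d.-tuple bool}) :
  \sum_(u | Q u) pmf u = fine (P [set w | Q (joint w)]).
Proof. by rewrite (prob_preimage_fin P measurable_joint). Qed.

Let agree (k : nat) (u v : {ffun 'I_n -> d.-tuple bool}) : bool :=
  [forall j : 'I_n, (j < k)%N ==> (u j == v j)].

Local Lemma agreeP k u v :
  reflect (forall j : 'I_n, (j < k)%N -> u j = v j) (agree k u v).
Proof.
apply: (iffP forallP) => uv j; last by apply/implyP => /uv ->.
by move=> jk; apply/eqP; exact: implyP (uv j) jk.
Qed.

(** Splitting by the value v of the draw of index k, each joint probability with the history is
    P(history) times the Bernoulli weight of v; [Bernoulli_mean] then sums over v. *)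
Local Lemma sum_agree_pmf (k : 'I_n) h i :
  \sum_(u | agree k u h) pmf u * (tnth (u k) i)%:R =
  \sum_(u | agree k u h) pmf u * DBparam p alpha h k 0 i.
Proof.
set B := [set w | forall j : 'I_n, (j < k)%N -> Z j w = h j].
have BE : B = [set w | agree k (joint w) h].
  apply/seteqP; split=> w /= Bw.
    by apply/agreeP => j jk; rewrite ffunE Bw.
  by move=> j jk; move/agreeP/(_ j jk): Bw; rewrite ffunE.
have mB : measurable B.
  rewrite BE.
  exact: (measurable_preimage_fin measurable_joint [set u | agree k u h]).
rewrite -mulr_suml sum_pmf -BE -(Bernoulli_mean (DBparam p alpha h k) i).
rewrite mulr_sumr (partition_big (fun u => u k) xpredT) //=.
apply: eq_bigr => v _; rewrite mulrA.
rewrite (eq_bigr (fun u => pmf u * (tnth v i)%:R)); last first.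
  by move=> u /andP[_ /eqP ->].
rewrite -mulr_suml sum_pmf; congr (_ * _).
have -> : [set w | agree k (joint w) h && (joint w k == v)] =
    Z k @^-1` [set v] `&` B.
  rewrite BE; apply/seteqP; split=> w /=.
    by rewrite ffunE => /andP[? /eqP].
  by rewrite ffunE => -[-> ->]; rewrite eqxx.
have mZ : measurable (Z k @^-1` [set v]).
  by apply: measurable_funPTI; exact: measurable_tuple1.
(* The sampling rule says nothing about a null history, but there both sides vanish. *)
have [B0|B0] := eqVneq (P B) 0%E.
  rewrite B0 mul0r; suff -> : P (Z k @^-1` [set v] `&` B) = 0%E by [].
  apply/eqP; rewrite eq_le measure_ge0 andbT -B0.
  by apply: le_measure; rewrite ?inE //; exact: measurableI.
rewrite -(Z_DB B0 v) /cond_pr mulrC divfK // fine_eq0 //.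
exact: fin_num_measure.
Qed.

(** On each class of outcomes sharing a history before [k], both [g] and the parameter are constant,
    which reduces the claim to [sum_agree_pmf]. *)
Local Lemma sum_pmf_DBparam (k : 'I_n) i
    (g : {ffun 'I_n -> d.-tuple bool} -> R) :
  (forall u v, agree k u v -> g u = g v) ->
  \sum_u pmf u * (g u * (tnth (u k) i)%:R) =
  \sum_u pmf u * (g u * DBparam p alpha u k 0 i).
Proof.
move=> g_prefix.
(* Overwriting the entries from [k] on by zero vectors gives a map whose nonempty fibres are the
   classes of [agree k]. *)
pose cut (u : {ffun 'I_n -> d.-tuple bool}) :=
  [ffun j : 'I_n => if (j < k)%N then u j else [tuple of nseq d false]].
have cutE u v : (cut u == cut v) = agree k u v.
  apply/eqP/agreeP => [/ffunP uv j jk|uv].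
    by have := uv j; rewrite !ffunE jk.
  by apply/ffunP => j; rewrite !ffunE; case: ifP => // /uv.
rewrite (partition_big cut xpredT) //= [RHS](partition_big cut xpredT) //=.
apply: eq_bigr => h _.
case: (pickP (fun u => cut u == h)) => [v /eqP <-|no_v]; last first.
  by rewrite !big_pred0.
under eq_bigl do rewrite cutE; under [RHS]eq_bigl do rewrite cutE.
transitivity (g v * \sum_(u | agree k u v) pmf u * (tnth (u k) i)%:R).
  by rewrite mulr_sumr; apply: eq_bigr => u /g_prefix ->; rewrite mulrCA.
rewrite sum_agree_pmf mulr_sumr; apply: eq_bigr => u uv.
rewrite (g_prefix _ _ uv) mulrCA (@eq_DBparam _ _ _ p _ u v) //.
exact/agreeP.
Qed.

(** The value 0 is allowed so as to include i.i.d. sampling; the next two bounds are those of the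
    minimum with denominators cleared. *)
Hypothesis alpha_ge0 : 0 <= alpha.
Hypothesis alpha_le1 : forall i, alpha * p 0 i <= 1 - p 0 i.
Hypothesis alpha_le2 : forall i, alpha * (1 - p 0 i) <= p 0 i.

Lemma sum_pmf1 : \sum_u pmf u = 1.
Proof.
rewrite sum_pmf; rewrite (_ : [set w | _] = setT) ?probability_setT //.
by apply/seteqP; split.
Qed.

Lemma pmf_step (k : 'I_n) i (g : {ffun 'I_n -> d.-tuple bool} -> R) :
  (forall u v, (forall j : 'I_n, (j < k)%N -> u j = v j) -> g u = g v) ->
  \sum_u pmf u * (g u * (tnth (u k) i)%:R) =
  \sum_u pmf u * (g u * (p 0 i - alpha / k%:R * deviation p u k i)).
Proof.
move=> g_prefix; rewrite sum_pmf_DBparam; last first.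
  by move=> u v /agreeP; exact: g_prefix.
by apply: eq_bigr => u _; rewrite DBparamE // ltnW.
Qed.

Lemma expectation_sqr_discrepancy : (0 < n)%N ->
  'E_P[fun w => (enorm (discrepancy p (fun k => Z k w)) ^+ 2)%R]%E =
  (n%:R ^- 2 * \sum_i second_moment p i pmf n)%:E.
Proof.
move=> n0; pose f u := enorm (discrepancy p u) ^+ 2.
transitivity ('E_P[fun w => f (joint w)])%E.
  congr expectation; apply/funext => w; congr (enorm (discrepancy p _) ^+ 2).
  by apply/funext => k; rewrite ffunE.
rewrite expectation_fin; last exact: measurable_joint.
congr EFin; rewrite exchange_big /= mulr_sumr; apply: eq_bigr => u _.
by rewrite /f sqr_enorm_discrepancy // mulrCA -mulr_sumr.
Qed.

Lemma expectation_sqr_discrepancy_alpha0 : alpha = 0 -> (0 < n)%N ->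
  'E_P[fun w => (enorm (discrepancy p (fun k => Z k w)) ^+ 2)%R]%E =
  (n%:R ^- 2 * \sum_i n%:R * (p 0 i * (1 - p 0 i)))%:E.
Proof.
move=> a0 n0; rewrite expectation_sqr_discrepancy //.
congr (_ * _)%:E; apply: eq_bigr => i _.
by apply: (second_moment_alpha0 sum_pmf1 _ a0) => // k g; exact: pmf_step.
Qed.

Lemma expectation_sqr_discrepancy_lt : 0 < alpha -> (0 < d)%N -> (1 < n)%N ->
  (forall i, 0 < p 0 i < 1) ->
  ('E_P[fun w => (enorm (discrepancy p (fun k => Z k w)) ^+ 2)%R] <
   (n%:R ^- 2 * \sum_i n%:R * (p 0 i * (1 - p 0 i)))%:E)%E.
Proof.
move=> a0 d0 n1 hp; have n0 : (0 < n)%N by exact: ltnW.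
rewrite expectation_sqr_discrepancy // lte_fin ltr_pM2l; last first.
  by rewrite invr_gt0 exprn_gt0 // ltr0n.
(* Strictness of the sum needs at least one coordinate, hence d >= 1. *)
apply: ltr_sum => [|i _].
  by apply/hasP; exists (Ordinal d0); rewrite ?mem_index_enum.
apply: (second_moment_lt pmf_ge0 sum_pmf1 _ a0) => //; last by rewrite n1 leqnn.
by move=> k g; exact: pmf_step.
Qed.

End DBsample.

(** * Independent samples as the case alpha = 0, and the comparison *)

(** With alpha = 0 the feedback disappears and the parameter is always p; by independence,
    conditioning on the history does not change the law of the next sample. *)
Lemma iid_is_DBsample (R : realType) (d n : nat) (p : 'rV[R]_d)
    (dO : measure_display) (Omega : measurableType dO)
    (P : probability Omega R) (X : 'I_n -> {RV P >-> d.-tuple bool}) :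
  (forall i, 0 <= p 0 i <= 1) ->
  mutually_independent P X -> (forall k, has_Bernoulli_law P p (X k)) ->
  is_DBsample P p 0 X.
Proof.
move=> hp indep law k u B B0 v.
have -> : DBparam p 0 u k = p.
  apply/rowP => i; have /andP[p0 p1] := hp i.
  by rewrite DBparamE ?(ltnW (ltn_ord k)) // ?mul0r ?subr0 // subr_ge0.
have mv j w : measurable (X j @^-1` [set w]).
  by apply: measurable_funPTI; exact: measurable_tuple1.
pose J := [set j : 'I_n | (j < k)%N]%SET.
have PB : P B = (\prod_(j in J) P (X j @^-1` [set u j]))%E.
  rewrite -indep; last by move=> j; exact: measurable_tuple1.
  congr (P _); apply/seteqP; split=> w /= Bw j.
    by rewrite /= inE => /Bw.
  by move=> jk; apply: Bw; rewrite /= inE.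
have PAB : P (X k @^-1` [set v] `&` B) = (P (X k @^-1` [set v]) * P B)%E.
  (* One family of events serves twice: over [J] it yields the history, over [k |: J] the history
     together with the draw [v]. *)
  pose A (j : 'I_n) := if j == k then [set v] else [set u j].
  have Ak : A k = [set v] by rewrite /A eqxx.
  have Aj (j : 'I_n) : (j < k)%N -> A j = [set u j].
    by move=> jk; rewrite /A -val_eqE /= ltn_eqF.
  have mA j : measurable (A j).
    by rewrite /A; case: ifP => _; exact: measurable_tuple1.
  have -> : P B = (\prod_(j in J) P (X j @^-1` A j))%E.
    by rewrite PB; apply: eq_bigr => j; rewrite inE => /Aj ->.
  have := indep (k |: J)%SET A mA.
  rewrite big_setU1 ?inE ?ltnn //= Ak => <-.
  congr (P _); apply/seteqP; split=> w /=.
    case=> Xv Bw j /=; rewrite !inE => /orP[/eqP ->|jk]; first by rewrite Ak.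
    by rewrite Aj //; exact: Bw.
  move=> Aw; split; first by have := Aw k; rewrite /= !inE eqxx Ak => /(_ isT).
  by move=> j jk; have := Aw j; rewrite /= !inE jk orbT Aj // => /(_ isT).
have mB : measurable B.
  have -> : B = \bigcap_(j in [set j : 'I_n | (j < k)%N]) (X j @^-1` [set u j]).
    by [].
  by apply: fin_bigcap_measurable.
have finB : P B \is a fin_num by exact: fin_num_measure.
rewrite /cond_pr PAB fineM ?fin_num_measure // mulfK ?fine_eq0 //.
by have := law k v; rewrite /distribution /= /pushforward => ->.
Qed.

Theorem proposition2p1 (R : realType) (d n : nat) (hd : (1 <= d)%N)
    (hn : (2 <= n)%N) (p : 'rV[R]_d) (hp : forall i, 0 < p 0 i < 1)
    (dX : measure_display) (OmegaX : measurableType dX)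
    (PX : probability OmegaX R) (X : 'I_n -> {RV PX >-> d.-tuple bool})
    (X_indep : mutually_independent PX X)
    (X_law : forall k, has_Bernoulli_law PX p (X k))
    (alpha : R) (alpha_gt0 : 0 < alpha)
    (alpha_le : forall i,
       alpha <= Num.min ((1 - p 0 i) / p 0 i) (p 0 i / (1 - p 0 i)))
    (dZ : measure_display) (OmegaZ : measurableType dZ)
    (PZ : probability OmegaZ R) (Z : 'I_n -> {RV PZ >-> d.-tuple bool})
    (Z_DB : is_DBsample PZ p alpha Z) :
  ('E_PZ[fun w => (enorm (discrepancy p (fun k => Z k w)) ^+ 2)%R] <
   'E_PX[fun w => (enorm (discrepancy p (fun k => X k w)) ^+ 2)%R])%E.
Proof.
have n0 : (0 < n)%N by exact: ltnW.
have hp01 i : 0 <= p 0 i <= 1 by case/andP: (hp i) => /ltW -> /ltW.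
have le1 i : alpha * p 0 i <= 1 - p 0 i.
  have /andP[p0 p1] := hp i; have := alpha_le i.
  by rewrite le_min => /andP[+ _]; rewrite ler_pdivlMr.
have le2 i : alpha * (1 - p 0 i) <= p 0 i.
  have /andP[p0 p1] := hp i; have := alpha_le i.
  by rewrite le_min => /andP[_]; rewrite ler_pdivlMr // subr_gt0.
have X_DB := iid_is_DBsample hp01 X_indep X_law.
have le01 i : 0 * p 0 i <= 1 - p 0 i.
  by rewrite mul0r subr_ge0; case/andP: (hp01 i).
have le02 i : 0 * (1 - p 0 i) <= p 0 i by rewrite mul0r; case/andP: (hp01 i).
(* The i.i.d. side is evaluated exactly, and this value strictly bounds the other side. *)
rewrite (expectation_sqr_discrepancy_alpha0 X_DB) //.
by apply: (expectation_sqr_discrepancy_lt Z_DB) => //; exact: ltW.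
Qed.
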